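(* If an s-hypersequent $\alpha_1\vdash\beta_1\mid\dots\mid\alpha_n\vdash\beta_n$ is provable in $\mathbf{MPDBL4}$, then it is valid in the class $\mathcal{KC}_{RT}$ of all reflexive and transitive Kripke contexts.
   Context: The logic PDBL. Variables: object variables $\mathbf{OV}$ ($p,\dots$) and property variables $\mathbf{PV}$ ($P,\dots$), disjoint countably infinite sets; constants $\top,\bot$; connectives $\sqcap,\sqcup$ (binary), $\neg,\lrcorner$ (unary). $\alpha\vee\beta:=\neg(\neg\alpha\sqcap\neg\beta)$, $\alpha\wedge\beta:=\lrcorner(\lrcorner\alpha\sqcup\lrcorner\beta)$. Sequents $\alpha\vdash\beta$ ($\alpha\dashv\vdash\beta$ means both directions); s-hypersequents are finite sequences $\alpha_1\vdash\beta_1\mid\dots\mid\alpha_n\vdash\beta_n$ (components); $B,C,\dots,X$ range over possibly empty s-hypersequents. Axioms: $\alpha\vdash\alpha$; $\alpha\sqcap\beta\vdash\alpha$; $\alpha\sqcap\beta\vdash\beta$; $\alpha\vdash\alpha\sqcup\beta$; $\beta\vdash\alpha\sqcup\beta$; $\alpha\sqcap\beta\vdash(\alpha\sqcap\beta)\sqcap(\alpha\sqcap\beta)$; $(\alpha\sqcup\beta)\sqcup(\alpha\sqcup\beta)\vdash\alpha\sqcup\beta$; $\neg(\alpha\sqcap\alpha)\vdash\neg\alpha$; $\lrcorner\alpha\vdash\lrcorner(\alpha\sqcup\alpha)$; $\alpha\sqcap\neg\alpha\vdash\bot$; $\top\vdash\alpha\sqcup\lrcorner\alpha$; $\neg\neg(\alpha\sqcap\beta)\dashv\vdash\alpha\sqcap\beta$;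 $\lrcorner\lrcorner(\alpha\sqcup\beta)\dashv\vdash\alpha\sqcup\beta$; $\alpha\sqcap\alpha\vdash\alpha\sqcap(\alpha\sqcup\beta)$; $\alpha\sqcup(\alpha\sqcap\beta)\vdash\alpha\sqcup\alpha$; $\alpha\sqcap\alpha\vdash\alpha\sqcap(\alpha\vee\beta)$; $\alpha\sqcup(\alpha\wedge\beta)\vdash\alpha\sqcup\alpha$; $\alpha\sqcap(\beta\vee\gamma)\dashv\vdash(\alpha\sqcap\beta)\vee(\alpha\sqcap\gamma)$; $\alpha\sqcup(\beta\wedge\gamma)\dashv\vdash(\alpha\sqcup\beta)\wedge(\alpha\sqcup\gamma)$; $\bot\vdash\alpha$; $\alpha\vdash\top$; $\neg\top\vdash\bot$; $\top\vdash\lrcorner\bot$; $\neg\bot\dashv\vdash\top\sqcap\top$; $\lrcorner\top\dashv\vdash\bot\sqcup\bot$; $(\alpha\sqcup\alpha)\sqcap(\alpha\sqcup\alpha)\dashv\vdash(\alpha\sqcap\alpha)\sqcup(\alpha\sqcap\alpha)$; $p\sqcap p\dashv\vdash p$ ($p\in\mathbf{OV}$); $P\sqcup P\dashv\vdash P$ ($P\in\mathbf{PV}$); (Sp) $\alpha\vdash\alpha\sqcap\alpha\mid\alpha\sqcup\alpha\vdash\alpha$. Rules: from $B\mid\alpha\vdash\beta\mid C$ infer $B\mid\alpha\sqcap\gamma\vdash\beta\sqcap\gamma\mid C$, $B\mid\gamma\sqcap\alpha\vdash\gamma\sqcap\beta\mid C$, $B\mid\alpha\sqcup\gamma\vdash\beta\sqcup\gamma\mid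 C$, $B\mid\gamma\sqcup\alpha\vdash\gamma\sqcup\beta\mid C$, $B\mid\neg\beta\vdash\neg\alpha\mid C$, $B\mid\lrcorner\beta\vdash\lrcorner\alpha\mid C$; from $B\mid\alpha\vdash\beta\mid C$ and $D\mid\beta\vdash\gamma\mid E$ infer $B\mid D\mid\alpha\vdash\gamma\mid C\mid E$; from $B\mid\alpha\sqcap\beta\vdash\alpha\sqcap\alpha\mid C$, $D\mid\alpha\sqcap\alpha\vdash\alpha\sqcap\beta\mid E$, $F\mid\alpha\sqcup\beta\vdash\beta\sqcup\beta\mid G$, $H\mid\beta\sqcup\beta\vdash\alpha\sqcup\beta\mid X$ infer $B\mid D\mid F\mid H\mid\alpha\vdash\beta\mid C\mid E\mid G\mid X$; external: from $B\mid D\mid D\mid C$ infer $B\mid D\mid C$; from $B\mid D\mid E\mid C$ infer $B\mid E\mid D\mid C$; from $B$ infer $B\mid C$. MPDBL and MPDBL4. $\mathbf{MPDBL}$ adds unary connectives $\square,\blacksquare$ (the PDBL schemes and rules range over all formulae of the enlarged language), with additional axioms $\square\alpha\sqcap\square\beta\dashv\vdash\square(\alpha\sqcap\beta)$; $\blacksquare\alpha\sqcup\blacksquare\beta\dashv\vdash\blacksquare(\alpha\sqcup\beta)$; $\square(\neg\bot)\dashv\vdash\neg\bot$; $\blacksquare(\lrcorner\top)\dashv\vdash\lrcorner\top$; $\square(\alpha\sqcap\alpha)\dashv\vdash\square\alpha$; $\blacksquare(\alpha\sqcup\alpha)\dashv\vdash\blacksquare\alpha$, and rules: from $B\mid\alpha\vdash\beta\mid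 C$ infer $B\mid\square\alpha\vdash\square\beta\mid C$ and $B\mid\blacksquare\alpha\vdash\blacksquare\beta\mid C$. $\mathbf{MPDBL4}$ is $\mathbf{MPDBL}$ plus the axioms $\square\alpha\vdash\alpha$, $\alpha\vdash\blacksquare\alpha$, $\square\square\alpha\dashv\vdash\square\alpha$, $\blacksquare\blacksquare\alpha\dashv\vdash\blacksquare\alpha$. Provability is via finite derivations. Kripke contexts and semiconcepts. A Kripke context is $\mathbb{KC}=((G,R),(M,S),I)$ where $(G,M,I)$ is a context ($I\subseteq G\times M$), $R$ is a binary relation on $G$ and $S$ a binary relation on $M$; it is reflexive (resp. transitive) if both $R$ and $S$ are reflexive (resp. transitive). For $A\subseteq G$, $A'=\{m:gIm\ \forall g\in A\}$; for $B\subseteq M$, $B'=\{g:gIm\ \forall m\in B\}$. A semiconcept of $(G,M,I)$ is a pair $(A,B)$ with $A'=B$ or $B'=A$; $ext(A,B)=A$, $int(A,B)=B$; $\mathfrak{H}$ denotes the set of semiconcepts with operations $(A_1,B_1)\sqcap(A_2,B_2)=(A_1\cap A_2,(A_1\cap A_2)')$, $(A_1,B_1)\sqcup(A_2,B_2)=((B_1\cap B_2)',B_1\cap B_2)$. Models. A model is $\mathbb{M}=(\mathbb{KC},v)$ with $v$ a map on $\mathbf{OV}\cup\mathbf{PV}\cup\{\top,\bot\}$ into $\mathfrak{H}$ with $v(p)\sqcap v(p)=v(p)$ ($p\in\mathbf{OV}$), $v(P)\sqcup v(P)=v(P)$ ($P\in\mathbf{PV}$), $v(\top)=(G,\emptyset)$,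 $v(\bot)=(\emptyset,M)$. Satisfaction $g\models\alpha$ ($g\in G$) and co-satisfaction $m\succ\alpha$ ($m\in M$): $g\models p$ iff $g\in ext(v(p))$; $g\models P$ iff $g\in ext(v(P))$; $g\models\top$ always; $g\not\models\bot$ always; $m\not\succ\top$ always; $m\succ\bot$ always; $g\models\alpha\sqcap\beta$ iff $g\models\alpha$ and $g\models\beta$; $g\models\neg\alpha$ iff $g\not\models\alpha$; $m\succ p$ iff $m\in int(v(p))$; $m\succ P$ iff $m\in int(v(P))$; $m\succ\alpha\sqcup\beta$ iff $m\succ\alpha$ and $m\succ\beta$; $m\succ\lrcorner\alpha$ iff $m\not\succ\alpha$; $g\models\alpha\sqcup\beta$ iff $\forall m(m\succ\alpha\sqcup\beta\Rightarrow gIm)$; $g\models\lrcorner\alpha$ iff $\forall m(m\not\succ\alpha\Rightarrow gIm)$; $m\succ\neg\alpha$ iff $\forall g(g\not\models\alpha\Rightarrow gIm)$; $m\succ\alpha\sqcap\beta$ iff $\forall g(g\models\alpha\sqcap\beta\Rightarrow gIm)$; $g\models\square\alpha$ iff for all $g_1$ with $gRg_1$, $g_1\models\alpha$; $m\succ\square\alpha$ iff $gIm$ for every $g\in G$ such that ($g_1\models\alpha$ for all $g_1$ with $gRg_1$); $m\succ\blacksquare\alpha$ iff for all $m_1$ with $mSm_1$, $m_1\succ\alpha$; $g\models\blacksquare\alpha$ iff $gIm$ for every $m\in M$ such that ($m_1\succ\alpha$ for all $m_1$ with $mSm_1$). A sequent $\alpha\vdash\beta$ is satisfied in $\mathbb{M}$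 iff $\forall g(g\models\alpha\Rightarrow g\models\beta)$ and $\forall m(m\succ\beta\Rightarrow m\succ\alpha)$; an s-hypersequent is satisfied iff some component is; true in $\mathbb{KC}$ iff satisfied in every model based on $\mathbb{KC}$; valid in a class iff true in each member. *)

(* Defs.v *)
(* Sets are the [set T] of mathcomp.classical, so that [=] on extents and intents
   is extensional equality. *)
From Stdlib Require List.
From Stdlib Require Import RelationClasses.
From mathcomp Require Import all_boot.
From mathcomp Require Import boolp classical_sets.

Set Implicit Arguments.
Unset Strict Implicit.
Unset Printing Implicit Defensive.

Local Open Scope classical_set_scope.

(* [OV n] and [PV n] are the object and the property variables. *)
Inductive atom : Type :=
| OV of nat
| PV of nat
| Top
| Bot.

Inductive formula : Type :=
| Atom of atom
| Meet of formula & formula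
| Join of formula & formula
| Neg of formula
| Opp of formula
| Box of formula
| BBox of formula.

Declare Scope formula_scope.
Delimit Scope formula_scope with F.
Bind Scope formula_scope with formula.

Notation "⊤" := (Atom Top) : formula_scope.
Notation "⊥" := (Atom Bot) : formula_scope.
Notation "a ⊓ b" := (Meet a b) (at level 40, left associativity) : formula_scope.
Notation "a ⊔ b" := (Join a b) (at level 50, left associativity) : formula_scope.
Notation "¬ a" := (Neg a) (at level 35, right associativity) : formula_scope.
Notation "⌟ a" := (Opp a) (at level 35, right associativity) : formula_scope.
Notation "□ a" := (Box a) (at level 35, right associativity) : formula_scope.
Notation "■ a" := (BBox a) (at level 35, right associativity) : formula_scope.

Local Open Scope formula_scope.

Definition vee (a b : formula) : formula := ¬ (¬ a ⊓ ¬ b).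
Definition wedge (a b : formula) : formula := ⌟ (⌟ a ⊔ ⌟ b).

Notation "a ∨ b" := (vee a b) (at level 50, left associativity) : formula_scope.
Notation "a ∧ b" := (wedge a b) (at level 40, left associativity) : formula_scope.

Record sequent : Type := Sequent { antecedent : formula; succedent : formula }.

Notation "a ⊢ b" := (Sequent a%F b%F) (at level 55, no associativity).

Definition hypersequent : Type := seq sequent.

Inductive pdbl_seq : sequent -> Prop :=
| pdbl_refl a : pdbl_seq (a ⊢ a)
| pdbl_meetl a b : pdbl_seq (a ⊓ b ⊢ a)
| pdbl_meetr a b : pdbl_seq (a ⊓ b ⊢ b)
| pdbl_joinl a b : pdbl_seq (a ⊢ a ⊔ b)
| pdbl_joinr a b : pdbl_seq (b ⊢ a ⊔ b)
| pdbl_meet_idem a b : pdbl_seq (a ⊓ b ⊢ (a ⊓ b) ⊓ (a ⊓ b))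
| pdbl_join_idem a b : pdbl_seq ((a ⊔ b) ⊔ (a ⊔ b) ⊢ a ⊔ b)
| pdbl_neg_meet a : pdbl_seq (¬ (a ⊓ a) ⊢ ¬ a)
| pdbl_opp_join a : pdbl_seq (⌟ a ⊢ ⌟ (a ⊔ a))
| pdbl_meet_neg a : pdbl_seq (a ⊓ ¬ a ⊢ ⊥)
| pdbl_join_opp a : pdbl_seq (⊤ ⊢ a ⊔ ⌟ a)
| pdbl_meet_join a b : pdbl_seq (a ⊓ a ⊢ a ⊓ (a ⊔ b))
| pdbl_join_meet a b : pdbl_seq (a ⊔ (a ⊓ b) ⊢ a ⊔ a)
| pdbl_meet_vee a b : pdbl_seq (a ⊓ a ⊢ a ⊓ (a ∨ b))
| pdbl_join_wedge a b : pdbl_seq (a ⊔ (a ∧ b) ⊢ a ⊔ a)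
| pdbl_bot a : pdbl_seq (⊥ ⊢ a)
| pdbl_top a : pdbl_seq (a ⊢ ⊤)
| pdbl_neg_top : pdbl_seq (¬ ⊤ ⊢ ⊥)
| pdbl_opp_bot : pdbl_seq (⊤ ⊢ ⌟ ⊥).

(* The axioms [a ⊣⊢ b]; each stands for both [a ⊢ b] and [b ⊢ a]. *)
Inductive pdbl_equiv : formula -> formula -> Prop :=
| pdbl_neg_neg a b : pdbl_equiv (¬ ¬ (a ⊓ b)) (a ⊓ b)
| pdbl_opp_opp a b : pdbl_equiv (⌟ ⌟ (a ⊔ b)) (a ⊔ b)
| pdbl_meet_distr a b c : pdbl_equiv (a ⊓ (b ∨ c)) ((a ⊓ b) ∨ (a ⊓ c))
| pdbl_join_distr a b c : pdbl_equiv (a ⊔ (b ∧ c)) ((a ⊔ b) ∧ (a ⊔ c))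
| pdbl_neg_bot : pdbl_equiv (¬ ⊥) (⊤ ⊓ ⊤)
| pdbl_opp_top : pdbl_equiv (⌟ ⊤) (⊥ ⊔ ⊥)
| pdbl_double a : pdbl_equiv ((a ⊔ a) ⊓ (a ⊔ a)) ((a ⊓ a) ⊔ (a ⊓ a))
| pdbl_OV n : pdbl_equiv (Atom (OV n) ⊓ Atom (OV n)) (Atom (OV n))
| pdbl_PV n : pdbl_equiv (Atom (PV n) ⊔ Atom (PV n)) (Atom (PV n)).

Inductive PDBL_axiom : hypersequent -> Prop :=
| PDBL_seq s : pdbl_seq s -> PDBL_axiom [:: s]
| PDBL_equivl a b : pdbl_equiv a b -> PDBL_axiom [:: a ⊢ b]
| PDBL_equivr a b : pdbl_equiv a b -> PDBL_axiom [:: b ⊢ a]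
| PDBL_Sp a : PDBL_axiom [:: a ⊢ a ⊓ a; a ⊔ a ⊢ a].

Inductive mpdbl_equiv : formula -> formula -> Prop :=
| mpdbl_box_meet a b : mpdbl_equiv (□ a ⊓ □ b) (□ (a ⊓ b))
| mpdbl_bbox_join a b : mpdbl_equiv (■ a ⊔ ■ b) (■ (a ⊔ b))
| mpdbl_box_neg_bot : mpdbl_equiv (□ (¬ ⊥)) (¬ ⊥)
| mpdbl_bbox_opp_top : mpdbl_equiv (■ (⌟ ⊤)) (⌟ ⊤)
| mpdbl_box_idem a : mpdbl_equiv (□ (a ⊓ a)) (□ a)
| mpdbl_bbox_idem a : mpdbl_equiv (■ (a ⊔ a)) (■ a).

Inductive MPDBL_axiom : hypersequent -> Prop :=
| MPDBL_PDBL H : PDBL_axiom H -> MPDBL_axiom H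
| MPDBL_equivl a b : mpdbl_equiv a b -> MPDBL_axiom [:: a ⊢ b]
| MPDBL_equivr a b : mpdbl_equiv a b -> MPDBL_axiom [:: b ⊢ a].

Inductive MPDBL4_axiom : hypersequent -> Prop :=
| MPDBL4_MPDBL H : MPDBL_axiom H -> MPDBL4_axiom H
| MPDBL4_box_T a : MPDBL4_axiom [:: □ a ⊢ a]
| MPDBL4_bbox_T a : MPDBL4_axiom [:: a ⊢ ■ a]
| MPDBL4_box_4l a : MPDBL4_axiom [:: □ □ a ⊢ □ a]
| MPDBL4_box_4r a : MPDBL4_axiom [:: □ a ⊢ □ □ a]
| MPDBL4_bbox_4l a : MPDBL4_axiom [:: ■ ■ a ⊢ ■ a]
| MPDBL4_bbox_4r a : MPDBL4_axiom [:: ■ a ⊢ ■ ■ a].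

(* Derivability by the rules of PDBL and the two modal rules of MPDBL, from the
   axioms [Ax]. *)
Inductive derivable (Ax : hypersequent -> Prop) : hypersequent -> Prop :=
| der_axiom H : Ax H -> derivable Ax H
| der_meetl B C a b c :
    derivable Ax (B ++ [:: a ⊢ b] ++ C) ->
    derivable Ax (B ++ [:: a ⊓ c ⊢ b ⊓ c] ++ C)
| der_meetr B C a b c :
    derivable Ax (B ++ [:: a ⊢ b] ++ C) ->
    derivable Ax (B ++ [:: c ⊓ a ⊢ c ⊓ b] ++ C)
| der_joinl B C a b c :
    derivable Ax (B ++ [:: a ⊢ b] ++ C) ->
    derivable Ax (B ++ [:: a ⊔ c ⊢ b ⊔ c] ++ C)
| der_joinr B C a b c :
    derivable Ax (B ++ [:: a ⊢ b] ++ C) ->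
    derivable Ax (B ++ [:: c ⊔ a ⊢ c ⊔ b] ++ C)
| der_neg B C a b :
    derivable Ax (B ++ [:: a ⊢ b] ++ C) ->
    derivable Ax (B ++ [:: ¬ b ⊢ ¬ a] ++ C)
| der_opp B C a b :
    derivable Ax (B ++ [:: a ⊢ b] ++ C) ->
    derivable Ax (B ++ [:: ⌟ b ⊢ ⌟ a] ++ C)
| der_cut B C D E a b c :
    derivable Ax (B ++ [:: a ⊢ b] ++ C) ->
    derivable Ax (D ++ [:: b ⊢ c] ++ E) ->
    derivable Ax (B ++ D ++ [:: a ⊢ c] ++ C ++ E)
| der_order B C D E F G H X a b :
    derivable Ax (B ++ [:: a ⊓ b ⊢ a ⊓ a] ++ C) ->
    derivable Ax (D ++ [:: a ⊓ a ⊢ a ⊓ b] ++ E) ->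
    derivable Ax (F ++ [:: a ⊔ b ⊢ b ⊔ b] ++ G) ->
    derivable Ax (H ++ [:: b ⊔ b ⊢ a ⊔ b] ++ X) ->
    derivable Ax (B ++ D ++ F ++ H ++ [:: a ⊢ b] ++ C ++ E ++ G ++ X)
| der_contraction B C D :
    derivable Ax (B ++ D ++ D ++ C) -> derivable Ax (B ++ D ++ C)
| der_exchange B C D E :
    derivable Ax (B ++ D ++ E ++ C) -> derivable Ax (B ++ E ++ D ++ C)
| der_weakening B C : derivable Ax B -> derivable Ax (B ++ C)
| der_box B C a b :
    derivable Ax (B ++ [:: a ⊢ b] ++ C) ->
    derivable Ax (B ++ [:: □ a ⊢ □ b] ++ C)
| der_bbox B C a b :
    derivable Ax (B ++ [:: a ⊢ b] ++ C) ->
    derivable Ax (B ++ [:: ■ a ⊢ ■ b] ++ C).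

Definition MPDBL4_provable (H : hypersequent) : Prop :=
  derivable MPDBL4_axiom H.

Record kripke_context : Type := KripkeContext {
  obj : Type;
  prop : Type;
  inc : obj -> prop -> Prop;
  robj : obj -> obj -> Prop;
  rprop : prop -> prop -> Prop
}.

Definition reflexive_kc (K : kripke_context) : Prop :=
  Reflexive (@robj K) /\ Reflexive (@rprop K).

Definition transitive_kc (K : kripke_context) : Prop :=
  Transitive (@robj K) /\ Transitive (@rprop K).

Definition KC_RT (K : kripke_context) : Prop :=
  reflexive_kc K /\ transitive_kc K.

Definition up (K : kripke_context) (A : set (obj K)) : set (prop K) :=
  [set m | forall g, A g -> inc g m].

Definition down (K : kripke_context) (B : set (prop K)) : set (obj K) :=
  [set g | forall m, B m -> inc g m].

(* Pairs (extent, intent). *)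
Definition concept_pair (K : kripke_context) : Type :=
  (set (obj K) * set (prop K))%type.

Definition semiconcept (K : kripke_context) (x : concept_pair K) : Prop :=
  up x.1 = x.2 \/ down x.2 = x.1.

Definition sc_meet (K : kripke_context) (x y : concept_pair K) :
    concept_pair K :=
  (x.1 `&` y.1, up (x.1 `&` y.1)).

Definition sc_join (K : kripke_context) (x y : concept_pair K) :
    concept_pair K :=
  (down (x.2 `&` y.2), x.2 `&` y.2).

Record model (K : kripke_context) : Type := Model {
  val_of : atom -> concept_pair K;
  val_semiconcept : forall x, semiconcept (val_of x);
  val_OV : forall n,
    sc_meet (val_of (OV n)) (val_of (OV n)) = val_of (OV n);
  val_PV : forall n,
    sc_join (val_of (PV n)) (val_of (PV n)) = val_of (PV n);
  val_Top : val_of Top = (setT, set0);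
  val_Bot : val_of Bot = (set0, setT)
}.

(* [sat M g a] is g ⊨ a and [cosat M m a] is m ≻ a. To keep the recursion
   structural, m ≻ a ⊔ b in the clause for g ⊨ a ⊔ b is replaced by its own
   clause, and likewise g ⊨ a ⊓ b in the clause for m ≻ a ⊓ b. *)
Fixpoint sat (K : kripke_context) (M : model K) (g : obj K) (f : formula)
    {struct f} : Prop :=
  match f with
  | Atom (OV n) => (val_of M (OV n)).1 g
  | Atom (PV n) => (val_of M (PV n)).1 g
  | Atom Top => True
  | Atom Bot => False
  | Meet a b => sat M g a /\ sat M g b
  | Join a b => forall m, cosat M m a /\ cosat M m b -> inc g m
  | Neg a => ~ sat M g a
  | Opp a => forall m, ~ cosat M m a -> inc g m
  | Box a => forall g1, robj g g1 -> sat M g1 a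
  | BBox a =>
      forall m, (forall m1, rprop m m1 -> cosat M m1 a) -> inc g m
  end
with cosat (K : kripke_context) (M : model K) (m : prop K) (f : formula)
    {struct f} : Prop :=
  match f with
  | Atom (OV n) => (val_of M (OV n)).2 m
  | Atom (PV n) => (val_of M (PV n)).2 m
  | Atom Top => False
  | Atom Bot => True
  | Meet a b => forall g, sat M g a /\ sat M g b -> inc g m
  | Join a b => cosat M m a /\ cosat M m b
  | Neg a => forall g, ~ sat M g a -> inc g m
  | Opp a => ~ cosat M m a
  | Box a =>
      forall g, (forall g1, robj g g1 -> sat M g1 a) -> inc g m
  | BBox a => forall m1, rprop m m1 -> cosat M m1 a
  end.

Definition sat_sequent (K : kripke_context) (M : model K) (s : sequent) : Prop :=
  (forall g, sat M g (antecedent s) -> sat M g (succedent s)) /\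
  (forall m, cosat M m (succedent s) -> cosat M m (antecedent s)).

Definition sat_hypersequent (K : kripke_context) (M : model K)
    (H : hypersequent) : Prop :=
  List.Exists (sat_sequent M) H.

Definition true_in (K : kripke_context) (H : hypersequent) : Prop :=
  forall M : model K, sat_hypersequent M H.

Definition valid_in (C : kripke_context -> Prop) (H : hypersequent) : Prop :=
  forall K : kripke_context, C K -> true_in K H.

(* Main.v *)
(* Every formula denotes a semiconcept (A, B) of the context.  Hence a sequent
   whose antecedent has intent A' reduces to inclusion of extents, one whose
   succedent has extent B' reduces to inclusion of intents, and (Sp) is the
   dichotomy A' = B or B' = A. *)
From Stdlib Require List.
From mathcomp Require Import all_boot.
From mathcomp Require Import boolp classical_sets.
Require Import Defs.

Set Implicit Arguments.
Unset Strict Implicit.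
Unset Printing Implicit Defensive.

Local Open Scope classical_set_scope.

Section Semantics.
Variables (K : kripke_context) (M : model K).

Definition ext_of (a : formula) : set (obj K) := [set g | sat M g a].
Definition int_of (a : formula) : set (prop K) := [set m | cosat M m a].

Lemma down_up_down (B : set (prop K)) : down (up (down B)) = down B.
Proof.
apply/seteqP; split=> g Hg m Hm; first by apply: Hg => h; apply.
exact: Hm.
Qed.

(** For a compound formula one component is by definition the polar of the other: the intent is [up]
    of the extent for [Meet], [Neg], [Box], and the extent is [down] of the intent for [Join],
    [Opp], [BBox]. Atoms inherit the property from the valuation. *)
Lemma formula_semiconcept a : semiconcept (ext_of a, int_of a).
Proof.
case: a => [x|a b|a b|a|a|a|a]; try by [left | right].
have -> : (ext_of (Atom x), int_of (Atom x)) = val_of M x.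
  case: x => [n|n||].
  - by rewrite [RHS]surjective_pairing.
  - by rewrite [RHS]surjective_pairing.
  - by rewrite val_Top; congr pair; apply/seteqP; split.
  - by rewrite val_Bot; congr pair; apply/seteqP; split.
exact: val_semiconcept.
Qed.

Lemma sat_cosat_inc a g m : sat M g a -> cosat M m a -> inc g m.
Proof.
case: (formula_semiconcept a) => /= E ga ma.
- by have : int_of a m by []; rewrite -E; apply.
- by have : ext_of a g by []; rewrite -E; apply.
Qed.

(** An [m] in the intent of [b] is incident to the whole extent of [b], hence to that of [a], so it
    lies in [up (ext_of a)]. *)
Lemma sat_sequent_ext a b :
  up (ext_of a) = int_of a -> (forall g, sat M g a -> sat M g b) ->
  sat_sequent M (Sequent a b).
Proof.
move=> E sab; split=> //= m mb; suff : int_of a m by [].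
by rewrite -E => g /sab gb; exact: sat_cosat_inc gb mb.
Qed.

Lemma sat_sequent_int a b :
  down (int_of b) = ext_of b -> (forall m, cosat M m b -> cosat M m a) ->
  sat_sequent M (Sequent a b).
Proof.
move=> E sba; split=> //= g ga; suff : ext_of b g by [].
by rewrite -E => m /sba ma; exact: sat_cosat_inc ga ma.
Qed.

Lemma sat_sequent_eq a b :
  ext_of a = ext_of b -> int_of a = int_of b ->
  sat_sequent M (Sequent a b) /\ sat_sequent M (Sequent b a).
Proof.
move=> E F.
have e g : sat M g a = sat M g b := congr1 (@^~ g) E.
have f m : cosat M m a = cosat M m b := congr1 (@^~ m) F.
by split; split=> x /=; rewrite ?e ?f.
Qed.

(** Supplies for object variables the side condition of [sat_sequent_ext], which holds by conversion
    for [Meet], [Neg] and [Box]; here it is the intent part of the idempotence [val_OV]. *)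
Lemma val_OV_up n : up (ext_of (Atom (OV n))) = int_of (Atom (OV n)).
Proof. by have /(congr1 snd) /= := val_OV M n; rewrite setIid. Qed.

Lemma val_PV_down n : down (int_of (Atom (PV n))) = ext_of (Atom (PV n)).
Proof. by have /(congr1 fst) /= := val_PV M n; rewrite setIid. Qed.

Lemma pdbl_seq_sound s : pdbl_seq s -> sat_sequent M s.
Proof.
case=> {s} [a|a b|a b|a b|a b|a b|a b|a|a|a|a|a b|a b|a b|a b|a|a||];
  try by [ split => x /=; tauto
         | apply: sat_sequent_ext => // g /=; tauto
         | apply: sat_sequent_int => // m /=; tauto ].
(* The two absorption laws remain; they mix [sat] and [cosat] and rest on the incidence between
   extent and intent of [a]. *)
- apply: sat_sequent_ext => // g /= [ga _]; split=> // m [ma _].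
  exact: sat_cosat_inc ga ma.
- apply: sat_sequent_int => // m /= [ma _]; split=> // g [ga _].
  exact: sat_cosat_inc ga ma.
Qed.

(** With (A, B) the denotation of [a], the two sides are (B', B'') and (A'', A'). They agree both
    when A' = B and when B' = A, since a triple polar equals a single one. *)
Lemma meet_join_double a :
  let lhs := Meet (Join a a) (Join a a) in
  let rhs := Join (Meet a a) (Meet a a) in
  ext_of lhs = ext_of rhs /\ int_of lhs = int_of rhs.
Proof.
move=> lhs rhs.
have extl : ext_of lhs = down (int_of a).
  by rewrite -[int_of a]setIid -[RHS]setIid.
have intl : int_of lhs = up (down (int_of a)) by rewrite -extl.
have intr : int_of rhs = up (ext_of a).
  by rewrite -[ext_of a]setIid -[RHS]setIid.
have extr : ext_of rhs = down (up (ext_of a)) by rewrite -intr.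
rewrite extl intl extr intr.
case: (formula_semiconcept a) => /= E; rewrite -E.
- split=> //; apply/seteqP; split=> m Hm g Hg; last exact: Hg.
  by apply: Hm => n; apply.
- by rewrite down_up_down.
Qed.

Lemma pdbl_equiv_sound a b :
  pdbl_equiv a b ->
  sat_sequent M (Sequent a b) /\ sat_sequent M (Sequent b a).
Proof.
case=> {a b} [a b|a b|a b c|a b c|||a|n|n].
- split; apply: sat_sequent_ext => // g /=; last by tauto.
  exact: contrapT.
- split; apply: sat_sequent_int => // m /=; first by tauto.
  exact: contrapT.
- split; apply: sat_sequent_ext => // g /=.
  + by tauto.
  (* Since [vee] is defined by negations, [sat M g a] must be extracted from under a double
     negation. *)
  + by have := EM (sat M g a); tauto.
- split; apply: sat_sequent_int => // m /=.
  + by have := EM (cosat M m a); tauto.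
  + by tauto.
- by split; apply: sat_sequent_ext => // g /=; tauto.
- by split; apply: sat_sequent_int => // m /=; tauto.
- by have [] := meet_join_double a; exact: sat_sequent_eq.
- split.
  + by apply: sat_sequent_ext => // g [].
  + by apply: (sat_sequent_ext (@val_OV_up n)) => g.
- split.
  + by apply: (sat_sequent_int (@val_PV_down n)) => m.
  + by apply: sat_sequent_int => // m [].
Qed.

(** Each [Box] law compares extents and each [BBox] law intents, which leaves first-order statements
    about successors, true for arbitrary relations. *)
Lemma mpdbl_equiv_sound a b :
  mpdbl_equiv a b ->
  sat_sequent M (Sequent a b) /\ sat_sequent M (Sequent b a).
Proof.
case=> {a b} [a b|a b|||a|a];
  by [ split; apply: sat_sequent_ext => // g /=; firstorder
     | split; apply: sat_sequent_int => // m /=; firstorder ].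
Qed.

Lemma sat_cat H1 H2 :
  sat_hypersequent M (H1 ++ H2) <->
  sat_hypersequent M H1 \/ sat_hypersequent M H2.
Proof. exact: List.Exists_app. Qed.

Lemma sat_single s : sat_hypersequent M [:: s] <-> sat_sequent M s.
Proof. by split=> [/List.Exists_cons[|/List.Exists_nil]|] //; left. Qed.

Lemma PDBL_axiom_sound H : PDBL_axiom H -> sat_hypersequent M H.
Proof.
case=> {H} [s /pdbl_seq_sound Hs|a b|a b|a]; first exact/sat_single.
- by case/pdbl_equiv_sound => ? _; exact/sat_single.
- by case/pdbl_equiv_sound => _ ?; exact/sat_single.
case: (formula_semiconcept a) => /= E.
(* In (Sp), A' = B satisfies the first component and B' = A the second. *)
- by left; apply: sat_sequent_ext => // g /=; tauto.
- by right; left; apply: sat_sequent_int => // m /=; tauto.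
Qed.

Lemma MPDBL_axiom_sound H : MPDBL_axiom H -> sat_hypersequent M H.
Proof.
case=> {H} [H|a b|a b]; first exact: PDBL_axiom_sound.
- by case/mpdbl_equiv_sound => ? _; exact/sat_single.
- by case/mpdbl_equiv_sound => _ ?; exact/sat_single.
Qed.

(** Intents reverse the direction of a sequent, so transitivity yields □a ⊢ □□a on extents but ■■a ⊢
    ■a on intents; reflexivity yields the other four axioms. *)
Lemma MPDBL4_axiom_sound H :
  KC_RT K -> MPDBL4_axiom H -> sat_hypersequent M H.
Proof.
case=> -[Rr Sr] [Rt St]; case=> {H} [H|a|a|a|a|a|a];
  first exact: MPDBL_axiom_sound; apply/sat_single.
- by apply: sat_sequent_ext => // g; apply.
- by apply: sat_sequent_int => // m; apply.
- by apply: sat_sequent_ext => // g; apply.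
- by apply: sat_sequent_ext => // g /= Hg g1 R1 g2 R2; apply: Hg; exact: Rt R2.
- by apply: sat_sequent_int => // m /= Hm m1 S1 m2 S2; apply: Hm; exact: St S2.
- by apply: sat_sequent_int => // m; apply.
Qed.

Lemma sat_congr s t B C :
  (sat_sequent M s -> sat_sequent M t) ->
  sat_hypersequent M (B ++ [:: s] ++ C) ->
  sat_hypersequent M (B ++ [:: t] ++ C).
Proof. by rewrite !sat_cat !sat_single; tauto. Qed.

(** A satisfied side component survives into the conclusion, so only active components matter.
    Extents settle the rules for [Meet], [Neg], [Box], intents those for [Join], [Opp], [BBox]. *)
Lemma derivable_sound (Ax : hypersequent -> Prop) H :
  (forall H', Ax H' -> sat_hypersequent M H') ->
  derivable Ax H -> sat_hypersequent M H.
Proof.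
move=> AxP; elim=> {H}; first exact: AxP.
- move=> B C a b c _; apply: sat_congr => -[s _].
  by apply: sat_sequent_ext => // g /= [/s].
- move=> B C a b c _; apply: sat_congr => -[s _].
  by apply: sat_sequent_ext => // g /= [? /s].
- move=> B C a b c _; apply: sat_congr => -[_ s].
  by apply: sat_sequent_int => // m /= [/s].
- move=> B C a b c _; apply: sat_congr => -[_ s].
  by apply: sat_sequent_int => // m /= [? /s].
- move=> B C a b _; apply: sat_congr => -[s _].
  by apply: sat_sequent_ext => // g /= nb /s.
- move=> B C a b _; apply: sat_congr => -[_ s].
  by apply: sat_sequent_int => // m /= na /s.
- move=> B C D E a b c _ + _; rewrite !sat_cat !sat_single.
  suff : sat_sequent M (Sequent a b) -> sat_sequent M (Sequent b c) ->
         sat_sequent M (Sequent a c) by tauto.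
  by case=> s1 t1 [s2 t2]; split=> [g /s1/s2 | m /t2/t1].
- move=> B C D E F G H X a b _ + _ + _ + _; rewrite !sat_cat !sat_single.
  (* The meet premise carries g ⊨ a to g ⊨ b, and the join premise carries m ≻ b to m ≻ a. *)
  suff : sat_sequent M (Sequent (Meet a a) (Meet a b)) ->
         sat_sequent M (Sequent (Join a b) (Join b b)) ->
         sat_sequent M (Sequent a b) by tauto.
  case=> /= s _ [/= _ t]; split=> [g ga | m mb] /=.
  + by have [] := s g (conj ga ga).
  + by have [] := t m (conj mb mb).
- by move=> B C D _; rewrite !sat_cat; tauto.
- by move=> B C D E _; rewrite !sat_cat; tauto.
- by move=> B C _; rewrite !sat_cat; tauto.
- move=> B C a b _; apply: sat_congr => -[s _].
  by apply: sat_sequent_ext => // g /= Hg g1 /Hg /s.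
- move=> B C a b _; apply: sat_congr => -[_ s].
  by apply: sat_sequent_int => // m /= Hm m1 /Hm /s.
Qed.

End Semantics.

Theorem theorem82 (H : hypersequent) :
  MPDBL4_provable H -> valid_in KC_RT H.
Proof.
move=> dH K KRT M; apply: derivable_sound dH => H'.
exact: MPDBL4_axiom_sound.
Qed.
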